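(* Let $R$ and $S$ be infinite principal ideal domains that are not fields. Then the Macías spaces $M(R)$ and $M(S)$ are homeomorphic if and only if $|U(R)| = |U(S)|$ and $|\mathcal{P}_R| = |\mathcal{P}_S|$ (equality of cardinalities), where $U(\cdot)$ denotes the group of units and $\mathcal{P}_R$, $\mathcal{P}_S$ denote the sets of associate classes of prime elements of $R$ and $S$ respectively.
   Context: For a commutative integral domain $R$ with $1 \neq 0$, write $R^0 = R \setminus \{0\}$. For $k \in R^0$ let $\sigma_k^0 := \{s \in R^0 : \langle k \rangle + \langle s \rangle = R\}$, where $\langle k \rangle$ is the principal ideal generated by $k$. The sets $\sigma_k^0$ ($k \in R^0$) form a basis of a topology on $R^0$; the Macías space $M(R)$ is the set $R^0$ with this topology. Two elements $a,b \in R$ are associates if $a = ub$ for some unit $u$ of $R$. *)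

(* Defs.v *)
From HB Require Import structures.
From mathcomp Require Import all_boot all_order all_algebra.
From mathcomp Require Import all_classical.
From mathcomp Require Import topology.

Set Implicit Arguments.
Unset Strict Implicit.
Unset Printing Implicit Defensive.

Import GRing.Theory.

Local Open Scope classical_set_scope.
Local Open Scope ring_scope.

(* Unlike [idealr_closed] of ring_quotient.v, which is boolean and demands
   properness, these are all ideals, as subsets in the classical sense. *)
Definition is_ideal (R : idomainType) (I : set R) : Prop :=
  [/\ I 0,
      forall x y, I x -> I y -> I (x + y) &
      forall a x, I x -> I (a * x)].

Definition principal_ideal (R : idomainType) (a : R) : set R :=
  [set a * x | x in [set: R]].

Definition ideal_sum (R : idomainType) (I J : set R) : set R :=
  [set x + y | x in I & y in J].

Definition is_pid (R : idomainType) : Prop :=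
  forall I : set R, is_ideal I -> exists a : R, I = principal_ideal a.

Definition divides (R : idomainType) (a b : R) : Prop := exists c, b = a * c.

Definition is_prime (R : idomainType) (p : R) : Prop :=
  [/\ p != 0, p \isn't a GRing.unit &
      forall a b, divides p (a * b) -> divides p a \/ divides p b].

Definition associates (R : idomainType) (a b : R) : Prop :=
  exists2 u : R, u \is a GRing.unit & a = u * b.

Definition units (R : idomainType) : set R := [set u | u \is a GRing.unit].
Arguments units : clear implicits.

Definition prime_classes (R : idomainType) : set (set R) :=
  [set [set q | associates q p] | p in @is_prime R].
Arguments prime_classes : clear implicits.

Definition macias (R : idomainType) : Type := {x : R | x != 0}.

HB.instance Definition _ (R : idomainType) :=
  SubChoice.copy (macias R) {x : R | x != 0}.

Definition sigma0 (R : idomainType) (k : macias R) : set (macias R) :=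
  [set s | ideal_sum (principal_ideal (val k)) (principal_ideal (val s))
           = [set: R]].

Section MaciasTopology.
Variable R : idomainType.

(* A base point is only required by the interface [isBaseTopological]. *)
Definition macias1 : macias R := Sub 1 (oner_neq0 R).

HB.instance Definition _ := isPointed.Build (macias R) macias1.

Lemma sigma0P (k s : macias R) :
  sigma0 k s <-> exists a b : R, val k * a + val s * b = 1.
Proof.
split=> [ks|[a [b ab1]]].
  have : [set: R] 1 by [].
  by rewrite -ks => -[_ [a _ <-]] [_ [b _ <-]] <-; exists a, b.
apply/seteqP; split=> // x _.
exists (val k * (a * x)); first by exists (a * x).
exists (val s * (b * x)); first by exists (b * x).
by rewrite !mulrA -mulrDl ab1 mul1r.
Qed.

Lemma sigma0_cover : \bigcup_(k in [set: macias R]) sigma0 k = setT.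
Proof.
apply/seteqP; split=> // s _; exists macias1 => //.
by apply/sigma0P; exists 1, 0; rewrite mulr0 addr0 mulr1.
Qed.

Lemma sigma0_join (k l t : macias R) : [set: macias R] k -> [set: macias R] l ->
  sigma0 k t -> sigma0 l t ->
  exists m, [/\ [set: macias R] m, sigma0 m t &
                sigma0 m `<=` sigma0 k `&` sigma0 l].
Proof.
move=> _ _ /sigma0P[a [b ab]] /sigma0P[c [d cd]].
have kl : val k * val l != 0 by rewrite mulf_neq0 ?(valP k) ?(valP l).
exists (Sub (val k * val l) kl); split => //.
  apply/sigma0P; exists (a * c), (val k * a * d + b); rewrite SubK.
  rewrite mulrACA mulrDr (mulrCA (val t)) addrA -mulrDr cd mulr1.
  exact: ab.
move=> s /sigma0P[x [y]]; rewrite SubK => xy; split; apply/sigma0P.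
  by exists (val l * x), y; rewrite mulrA.
by exists (val k * x), y; rewrite mulrA (mulrC (val l)).
Qed.

HB.instance Definition _ :=
  @isBaseTopological.Build (macias R) (macias R) [set: macias R] (@sigma0 R)
    sigma0_cover sigma0_join.

End MaciasTopology.

Definition homeomorphic (X Y : topologicalType) : Prop :=
  exists (f : X -> Y) (g : Y -> X),
    [/\ continuous f, continuous g, cancel f g & cancel g f].

(* Main.v *)
(** Fix a prime in every class of associates. By unique factorization an element
   of R^0 is a unit together with a finite multiset of chosen primes, and its
   coprimality with another element depends only on the supports of the two
   multisets. Hence bijections between the units and between the chosen primes
   of R and S carry M(R) homeomorphically onto M(S). Conversely, the
   specialization preorder of M(R) compares sets of prime divisors: the units
   are its least elements, and the prime classes correspond to its atoms, so
   both cardinals are topological invariants. *)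

Require Import Defs.
From mathcomp Require Import all_boot all_order all_algebra.
From mathcomp Require Import all_classical.
From mathcomp Require Import topology.

Set Implicit Arguments.
Unset Strict Implicit.
Unset Printing Implicit Defensive.

Import GRing.Theory.

Local Open Scope classical_set_scope.
Local Open Scope card_scope.
Local Open Scope ring_scope.

(** * Cardinal equality through mutually inverse functions *)

Definition inverse_on {T U : Type} (A : set T) (B : set U)
    (f : T -> U) (g : U -> T) : Prop :=
  [/\ forall x, A x -> B (f x), forall y, B y -> A (g y),
      forall x, A x -> g (f x) = x & forall y, B y -> f (g y) = y].

Lemma inverse_on_sym {T U : Type} {A : set T} {B : set U} {f g} :
  inverse_on A B f g -> inverse_on B A g f.
Proof. by case. Qed.

Lemma card_eq_inverse {T U : Type} {A : set T} {B : set U} f g :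
  inverse_on A B f g -> A #= B.
Proof.
move=> [fAB gBA fK gK].
suff [h] : $|{bij A >-> B}| by exact: pcard_eq.
apply/bijPex; exists f; split.
- by move=> x; exact: fAB.
- by move=> x y /set_mem Ax /set_mem Ay exy; rewrite -(fK x)// exy fK.
- by move=> y By; exists (g y); [exact: gBA|exact: gK].
Qed.

(** Equinumerous sets only give maps between the subtypes of [A] and [B]. These are extended to the
    ambient types by the junk values [y0] and [x0], so that later constructions can apply them to
    plain ring elements. *)
Lemma inverse_of_card_eq {T U : Type} (x0 : T) (y0 : U)
    {A : set T} {B : set U} :
  A #= B -> exists f g, inverse_on A B f g.
Proof.
move=> /card_bijP[f [g fK gK]].
pose lift (V W : Type) (C : set V) (D : set W) (w : W) (h : C -> D) v :=
  if pselect (C v) is left Cv then val (h (SigSub (mem_set Cv))) else w.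
have liftE V W (C : set V) (D : set W) w (h : C -> D) (v : C) :
    lift V W C D w h (val v) = val (h v).
  rewrite /lift; case: pselect => [Cv|/(_ (set_mem (valP v)))//].
  by congr (val (h _)); exact: val_inj.
have exC V (C : set V) v : C v -> exists c : C, v = val c.
  by move=> Cv; exists (SigSub (mem_set Cv)).
exists (lift _ _ _ _ y0 f), (lift _ _ _ _ x0 g); split.
- by move=> x /(exC _ A)[c ->]; rewrite liftE; exact: set_mem (valP _).
- by move=> y /(exC _ B)[c ->]; rewrite liftE; exact: set_mem (valP _).
- by move=> x /(exC _ A)[c ->]; rewrite !liftE fK.
- by move=> y /(exC _ B)[c ->]; rewrite !liftE gK.
Qed.

(** * Divisibility, association and coprimality in a domain *)

Definition coprime_elts {R : idomainType} (a b : R) : Prop :=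
  exists x y, a * x + b * y = 1.

Section Divisibility.
Context {R : idomainType}.
Implicit Types a b c d p q u v x y : R.

Lemma divides_refl a : divides a a.
Proof. by exists 1; rewrite mulr1. Qed.

Lemma divides_trans b a c : divides a b -> divides b c -> divides a c.
Proof. by move=> [x ->] [y ->]; exists (x * y); rewrite mulrA. Qed.

Lemma divides_mulr a b c : divides a b -> divides a (b * c).
Proof. by move=> ab; apply: divides_trans ab _; exists c. Qed.

Lemma divides_mull a b c : divides a c -> divides a (b * c).
Proof. by rewrite mulrC; exact: divides_mulr. Qed.

Lemma divides_unit a u : u \is a GRing.unit -> divides a u ->
  a \is a GRing.unit.
Proof. by move=> uu [x ux]; move: uu; rewrite ux unitrM => /andP[]. Qed.

Lemma coprime_eltsC a b : coprime_elts a b -> coprime_elts b a.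
Proof. by move=> [x [y e]]; exists y, x; rewrite addrC. Qed.

Lemma coprime_elts_self a : coprime_elts a a -> a \is a GRing.unit.
Proof.
move=> [x [y]]; rewrite -mulrDr => e.
by apply: (@divides_unit _ 1); rewrite ?unitr1//; exists (x + y).
Qed.

Lemma coprime_elts_dvd b' a b :
  divides b' b -> coprime_elts a b -> coprime_elts a b'.
Proof. by move=> [c ->] [x [y e]]; exists x, (c * y); rewrite mulrA. Qed.

Lemma coprime_eltsM a b c : coprime_elts a b -> divides a (b * c) ->
  divides a c.
Proof.
move=> [x [y e]] [z bc]; exists (x * c + z * y).
by rewrite mulrDr !mulrA -bc -{1}[c]mul1r -e mulrDl; congr (_ + _); rewrite mulrAC.
Qed.

Lemma associates_sym a b : associates a b -> associates b a.
Proof.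
move=> [u uu ->]; exists u^-1; first by rewrite unitrV.
by rewrite mulKr.
Qed.

Lemma associates_trans b a c :
  associates a b -> associates b c -> associates a c.
Proof.
move=> [u uu ->] [v vu ->]; exists (u * v); first by rewrite unitrM uu.
by rewrite mulrA.
Qed.

Lemma associates_dvd a b : associates a b -> divides a b.
Proof.
move=> /associates_sym[u _ ->]; exists u; exact: mulrC.
Qed.

Lemma divides_associates a b :
  a != 0 -> divides a b -> divides b a -> associates b a.
Proof.
move=> a0 [x ->] [y e]; exists x; last exact: mulrC.
have xy : x * y = 1 by apply: (mulfI a0); rewrite mulrA -e mulr1.
by apply: (@divides_unit _ 1); rewrite ?unitr1//; exists y.
Qed.

(** With [q = p * x], the prime [q] divides [p] or [x]; in the second case cancelling [q] would make
    [p] a unit. *)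
Lemma prime_divides_associates p q :
  is_prime p -> is_prime q -> divides p q -> associates q p.
Proof.
move=> [p0 pu _] [q0 qu qP] [x e].
have : divides q (p * x) by rewrite -e; exact: divides_refl.
case/qP => [qp|[y e']]; first by apply: divides_associates => //; exists x.
case/negP: pu; apply: (@divides_unit _ 1); rewrite ?unitr1//; exists y.
by apply: (mulfI q0); rewrite mulr1 {1}e e' mulrCA.
Qed.

Lemma prime_associates p q : is_prime p -> associates q p -> is_prime q.
Proof.
move=> [p0 pu pP] aqp; have apq := associates_sym aqp.
have qp := associates_dvd aqp; have pq := associates_dvd apq.
split.
- by have [u uu ->] := aqp; rewrite mulf_neq0//; apply: contraTneq uu => ->;
    rewrite unitr0.
- by apply: contra pu => qu; exact: divides_unit qu pq.
- move=> a b qab; have [] := pP a b (divides_trans pq qab).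
  + by left; apply: divides_trans qp _.
  + by right; apply: divides_trans qp _.
Qed.

Lemma prime_dvd_prod p (s : seq R) : is_prime p ->
  divides p (\prod_(q <- s) q) -> exists2 q, q \in s & divides p q.
Proof.
move=> [p0 pu pP]; elim: s => [|q s IH].
  rewrite big_nil => p1; case/negP: pu.
  by apply: divides_unit p1; rewrite unitr1.
rewrite big_cons => /pP[pq|/IH[r rs pr]]; first by exists q; rewrite ?mem_head.
by exists r; rewrite // in_cons rs orbT.
Qed.

Lemma mem_dvd_prod q (s : seq R) : q \in s -> divides q (\prod_(r <- s) r).
Proof.
move=> qs; rewrite (perm_big _ (perm_to_rem qs)) big_cons.
by exists (\prod_(r <- rem q s) r).
Qed.

End Divisibility.

(** * Greatest common divisors and termination of factoring in a PID *)

Section PrincipalIdealDomain.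
Context {R : idomainType} (R_pid : is_pid R).
Implicit Types a b c d p q u v x y : R.

Lemma pid_bezout a b :
  exists2 d, exists x y, d = a * x + b * y & divides d a /\ divides d b.
Proof.
pose I : set R := [set z | exists x y, z = a * x + b * y].
have [|d Id] := R_pid (I := I).
  split.
  - by exists 0, 0; rewrite !mulr0 addr0.
  - move=> _ _ [x [y ->]] [x' [y' ->]]; exists (x + x'), (y + y').
    by rewrite !mulrDr addrACA.
  - move=> c _ [x [y ->]]; exists (c * x), (c * y).
    by rewrite mulrDr !(mulrCA c).
have dvdI z : I z -> divides d z by rewrite Id => -[c _ <-]; exists c.
exists d; first by have : I d by rewrite Id; exists 1; rewrite ?mulr1.
split; apply: dvdI; first by exists 1, 0; rewrite mulr1 mulr0 addr0.
by exists 0, 1; rewrite mulr1 mulr0 add0r.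
Qed.

(** Let [p = d * e] with [d] a gcd of [p] and [a]. If [p] divides [d], it divides [a]; if it divides
    [e], cancelling [p] makes [d] a unit. *)
Lemma prime_coprime p a : is_prime p -> ~ divides p a -> coprime_elts p a.
Proof.
move=> [p0 pu pP] pa; have [d [x [y dxy]] [[e pde] da]] := pid_bezout p a.
have [|[d' dd]|[e' ee]] := pP d e; first by rewrite -pde; exact: divides_refl.
  by case: pa; apply: divides_trans da; exists d'.
have de : e' * d = 1.
  by apply: (mulfI p0); rewrite mulr1 mulrA -ee mulrC.
(* Since [e'] is the inverse of [d], it rescales the Bézout identity for [d] to one for 1. *)
exists (x * e'), (y * e').
by rewrite !mulrA -mulrDl -dxy mulrC.
Qed.

(** The ascending chain condition: choice yields a sequence [s] in which each term is the next one
    times a nonunit, and the union of the ideals generated by its terms is principal. *)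
Lemma no_infinite_factoring (Q : R -> Prop) :
  (forall x, Q x -> x != 0) ->
  (forall x, Q x -> exists2 d, Q d &
     exists2 e, e \isn't a GRing.unit & x = d * e) ->
  forall x, ~ Q x.
Proof.
move=> Q0 QQ x Qx.
have next (z : {x | Q x}) : exists w : {x | Q x},
    exists2 e, e \isn't a GRing.unit & sval z = sval w * e.
  by case: z => z Qz /=; have [d Qd ?] := QQ z Qz; exists (exist _ d Qd).
have [f fP] := choice next.
pose s n := sval (iter n f (exist _ x Qx)).
have dvd_s m n : (m <= n)%N -> divides (s n) (s m).
  elim: n => [|n IH]; first by rewrite leqn0 => /eqP->; exact: divides_refl.
  rewrite leq_eqVlt => /predU1P[->|/IH]; first exact: divides_refl.
  apply: divides_trans; have [e _ E] := fP (iter n f (exist _ x Qx)).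
  by exists e.
pose I : set R := [set z | exists n, divides (s n) z].
have [|d Id] := R_pid (I := I).
  split.
  - by exists 0%N, 0; rewrite mulr0.
  - move=> a b [m ma] [n nb]; exists (maxn m n).
    have [a' ->] := divides_trans (dvd_s _ _ (leq_maxl m n)) ma.
    have [b' ->] := divides_trans (dvd_s _ _ (leq_maxr m n)) nb.
    by exists (a' + b'); rewrite mulrDr.
  - by move=> a y [n ny]; exists n; exact: divides_mull.
(* The generator [d] already lies in the ideal of some [s n], so [s n] divides [s n.+1] and the
   cofactor [e] is forced to be a unit. *)
have [n nd] : I d by rewrite Id; exists 1; rewrite ?mulr1.
have [c _ dc] : principal_ideal d (s n.+1).
  by rewrite -Id; exists n.+1; exact: divides_refl.
have [e /negP eu snE] : exists2 e, e \isn't a GRing.unit & s n = s n.+1 * e.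
  exact: fP.
have sn0 : s n.+1 != 0 by exact: Q0 (svalP (iter n.+1 f _)).
have [k nk] : divides (s n) (s n.+1).
  by apply: divides_trans nd _; exists c.
apply: eu; apply: (@divides_unit _ _ 1); rewrite ?unitr1//; exists k.
by apply: (mulfI sn0); rewrite mulrA -snE -nk mulr1.
Qed.

(** Irreducible elements of a PID are prime. Suppose [x] divides [a * b] and let [d] be a gcd of [x]
    and [a]: if [d] is a unit then [x] divides [b]; otherwise its cofactor in [x] is a unit and [x]
    divides [a]. *)
Lemma nonprime_factor x : x != 0 -> x \isn't a GRing.unit -> ~ is_prime x ->
  exists d e, [/\ d \isn't a GRing.unit, e \isn't a GRing.unit & x = d * e].
Proof.
move=> x0 xu xp; apply: contrapT => xirr; apply: xp; split=> // a b xab.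
have [d [s [t dst]] [[e xde] da]] := pid_bezout x a.
case: (boolP (d \is a GRing.unit)) => [du|du].
  right; apply: (@coprime_eltsM _ x a) => //.
  by exists (s * d^-1), (t * d^-1); rewrite !mulrA -mulrDl -dst divrr.
case: (boolP (e \is a GRing.unit)) => [eu|eu]; last by case: xirr; exists d, e.
left; apply: divides_trans da; exists e^-1.
by rewrite xde -mulrA divrr// mulr1.
Qed.

End PrincipalIdealDomain.

(** * Representatives of the prime classes and unique factorization *)

Definition prime_system {R : idomainType} (P : set R) : Prop :=
  [/\ forall p, P p -> is_prime p,
      forall q, is_prime q -> exists2 p, P p & associates q p &
      forall p q, P p -> P q -> associates p q -> p = q].

(** The list stands for a finite multiset of chosen primes; its order is immaterial. *)
Definition factorization {R : idomainType} (P : set R) (x u : R) (s : seq R) :=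
  [/\ u \is a GRing.unit, forall p, p \in s -> P p &
      x = u * \prod_(p <- s) p].

(** Choice picks [rep C] in each class [C]; the class is recovered as the set of associates of
    [rep C], so [rep] is a bijection onto its image. *)
Lemma prime_system_exists (R : idomainType) :
  exists2 P : set R, prime_system P & P #= prime_classes R.
Proof.
pose rep (C : set R) := xget 0 C.
have repP p : is_prime p -> associates (rep [set q | associates q p]) p.
  move=> _; apply: (@xgetPex _ 0 [set q | associates q p]).
  by exists p, 1; rewrite ?unitr1 ?mul1r.
have classE p q : associates p q ->
    [set r | associates r p] = [set r | associates r q].
  move=> pq; apply/seteqP; split=> r /= h; apply: associates_trans h _ => //.
  exact: associates_sym.
exists (rep @` prime_classes R).
  split.
  - by move=> _ [_ [p pp <-] <-]; exact: prime_associates pp (repP p pp).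
  - move=> q qp; exists (rep [set r | associates r q]).
      by exists [set r | associates r q] => //; exists q.
    exact: associates_sym (repP q qp).
  - move=> _ _ [_ [p pp <-] <-] [_ [q qq <-] <-] pq; congr rep.
    apply: classE; apply: associates_trans (repP q qq).
    by apply: associates_trans pq; exact: associates_sym (repP p pp).
rewrite card_eq_sym.
apply: (@card_eq_inverse _ _ _ _ rep (fun p => [set q | associates q p])).
split.
- by move=> C CP; exists C.
- by move=> _ [_ [p pp <-] <-]; exists (rep [set q | associates q p]) => //;
    exact: prime_associates pp (repP p pp).
- by move=> _ [p pp <-]; exact: classE (repP p pp).
- by move=> _ [_ [p pp <-] <-]; congr rep; exact: classE (repP p pp).
Qed.

Section Factorization.
Context {R : idomainType} (R_pid : is_pid R) {P : set R} (PP : prime_system P).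
Implicit Types (x y u v p : R) (s t : seq R).

(** The nonzero elements without a factorization satisfy the hypotheses of [no_infinite_factoring]:
    such an element is neither a unit nor prime, hence a product of two nonunits. *)
Lemma factorization_exists x : x != 0 -> exists u s, factorization P x u s.
Proof.
move=> x0; apply: contrapT => nx.
pose Q x := x != 0 /\ ~ exists u s, factorization P x u s.
apply: (@no_infinite_factoring R R_pid Q _ _ x) => //; first by move=> ? [].
move=> {}x {x0 nx}[x0 nx].
have xu : x \isn't a GRing.unit.
  apply/negP => xu; apply: nx; exists x, [::]; split=> //.
  by rewrite big_nil mulr1.
have [_ Prep _] := PP.
have xp : ~ is_prime x.
  move=> /Prep[p Pp [u uu xup]]; apply: nx; exists u, [:: p]; split=> //.
    by move=> q; rewrite inE => /eqP->.
  by rewrite big_seq1.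
have [d [e [du eu xde]]] := nonprime_factor R_pid x0 xu xp.
have [d0 e0] : d != 0 /\ e != 0.
  by move: x0; rewrite xde mulf_eq0 negb_or => /andP.
(* One of the two factors is again without a factorization, since concatenating factorizations of
   both would factor [x]. *)
have [[u [s [uu sP dE]]]|nd] := pselect (exists u s, factorization P d u s).
  exists e; last by exists d; rewrite // mulrC.
  split=> // -[v [t [vu tP eE]]]; apply: nx; exists (u * v), (s ++ t); split.
  - by rewrite unitrM uu.
  - by move=> p; rewrite mem_cat => /orP[/sP|/tP].
  - by rewrite xde dE eE big_cat mulrACA.
by exists d => //; exists e.
Qed.

(** A chosen prime that divides [x] divides some entry of [s], hence is associated to it, hence
    equals it because [P] meets each class once. The support of the list is thereby intrinsic to
    [x]. *)
Lemma prime_divides_factorization {x u s p} :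
  factorization P x u s -> P p -> (divides p x <-> p \in s).
Proof.
have [Pprime _ Pinj] := PP.
move=> [uu sP ->] Pp; split; last first.
  by move=> ps; apply: divides_mull; exact: mem_dvd_prod.
have pp := Pprime p Pp; have [_ pu pP] := pp.
move=> /pP[|/(prime_dvd_prod pp)[q qs pq]].
  by move=> /(divides_unit uu); rewrite (negPf pu).
rewrite (Pinj p q) ?sP//; last 1 first.
  by apply: associates_sym; apply: prime_divides_associates => //; exact: Pprime (sP _ qs).
by exact: sP.
Qed.

(** With one prime per class no unit can be shifted between factors, so even the unit is determined.
    The induction cancels the head of [s] from both factorizations. *)
Lemma factorization_unique x u s v t :
  factorization P x u s -> factorization P x v t -> u = v /\ perm_eq s t.
Proof.
have [Pprime _ Pinj] := PP.
elim: s x t => [|p s IH] x t xus xvt.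
  have xu : x \is a GRing.unit.
    by case: xus => uu _ ->; rewrite big_nil mulr1.
  case: t xvt => [|q t] xvt.
    by case: xus xvt => _ _ -> [_ _]; rewrite !big_nil !mulr1.
  have Pq : P q by case: xvt => _ + _; apply; exact: mem_head.
  have /(divides_unit xu) : divides q x.
    by apply/(prime_divides_factorization xvt) => //; exact: mem_head.
  by have [_ /negPf->] := Pprime q Pq.
have Pp : P p by case: xus => _ + _; apply; exact: mem_head.
have pt : p \in t.
  apply/(prime_divides_factorization xvt) => //.
  by apply/(prime_divides_factorization xus) => //; exact: mem_head.
have [p0 _ _] := Pprime p Pp.
have pst := perm_to_rem pt.
case: xus xvt => [uu sP xE] [vu tP xE'].
have [||->st] := IH (u * \prod_(q <- s) q) (rem p t).
- by split=> // q qs; apply: sP; rewrite in_cons qs orbT.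
- split=> // [q /mem_rem/tP//|].
  apply: (mulfI p0); transitivity x; first by rewrite xE big_cons mulrCA.
  by rewrite xE' (perm_big _ pst) big_cons mulrCA.
by split=> //; rewrite perm_sym (perm_trans pst)// perm_cons perm_sym.
Qed.

Lemma prime_divisor x : x != 0 -> x \isn't a GRing.unit ->
  exists2 p, is_prime p & divides p x.
Proof.
move=> x0 xu; have [u [s [uu sP xE]]] := factorization_exists x0.
have [Pprime _ _] := PP.
case: s => [|p s] in sP xE.
  by rewrite xE big_nil mulr1 uu in xu.
exists p; first by apply: Pprime; apply: sP; exact: mem_head.
by rewrite xE; apply: divides_mull; apply: mem_dvd_prod; exact: mem_head.
Qed.

(** If the gcd were not a unit, it would have a prime divisor, whose representative in [P] divides
    both [x] and [y]. Coprimality thus depends on supports only. *)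
Lemma coprime_eltsP x y : x != 0 ->
  coprime_elts x y <-> (forall p, P p -> divides p x -> ~ divides p y).
Proof.
have [Pprime Prep _] := PP.
move=> x0; split=> [xy p Pp px py|xy].
  have [_ /negP pu _] := Pprime p Pp; apply: pu; apply: coprime_elts_self.
  apply: coprime_elts_dvd px _; apply: coprime_eltsC.
  exact: coprime_elts_dvd py _.
have [d [s [t dst]] [dx dy]] := pid_bezout R_pid x y.
(* [prime_divisor] needs a nonzero gcd, which is where [x != 0] enters. *)
have d0 : d != 0.
  by apply: contra_neq x0 => d0; have [c ->] := dx; rewrite d0 mul0r.
case: (boolP (d \is a GRing.unit)) => [du|du].
  by exists (s * d^-1), (t * d^-1); rewrite !mulrA -mulrDl -dst divrr.
have [q qp qd] := prime_divisor d0 du.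
have [p Pp /associates_sym/associates_dvd pq] := Prep q qp.
have pd := divides_trans pq qd.
case: (xy p Pp).
- exact: divides_trans pd dx.
- exact: divides_trans pd dy.
Qed.

End Factorization.

(** * Carrying factorizations from one domain to another *)

Section Transfer.
Context {R S : idomainType} (P : set R) (f phi : R -> S).

(** [xget] selects some factorization, and by uniqueness the result does not depend on which. The
    default pair serves elements without a factorization, such as 0. *)
Definition transfer (x : R) : S :=
  let us := xget (1, [::]) [set us | factorization P x us.1 us.2] in
  f us.1 * \prod_(p <- us.2) phi p.

Lemma transferE x u s : is_pid R -> prime_system P -> factorization P x u s ->
  transfer x = f u * \prod_(p <- s) phi p.
Proof.
move=> R_pid PP xus; rewrite /transfer.
set us := xget _ _.
have xus' : factorization P x us.1 us.2.
  by apply: (@xgetPex _ (1, [::]) [set us | factorization P x us.1 us.2]);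
    exists (u, s).
have [-> st] := factorization_unique PP xus xus'.
by rewrite (perm_big _ st).
Qed.

End Transfer.

Section TransferBijection.
Context {R S : idomainType} (R_pid : is_pid R) (S_pid : is_pid S).
Context {P : set R} {Q : set S} (PP : prime_system P) (QQ : prime_system Q).
Context {f phi : R -> S} {f' phi' : S -> R}.
Hypotheses (ff' : inverse_on (units R) (units S) f f')
           (phiphi' : inverse_on P Q phi phi').

Let T := transfer P f phi.
Let T' := transfer Q f' phi'.

Lemma transfer_factorization x u s :
  factorization P x u s -> factorization Q (T x) (f u) (map phi s).
Proof.
have [fU _ _ _] := ff'; have [phiQ _ _ _] := phiphi'.
move=> xus; rewrite /T (transferE _ _ R_pid PP xus).
case: xus => uu sP _; split; [exact: fU| |by rewrite big_map].
by move=> _ /mapP[p ps ->]; apply: phiQ; exact: sP.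
Qed.

Lemma transfer_neq0 x : x != 0 -> T x != 0.
Proof.
have [Qprime _ _] := QQ.
move=> /(factorization_exists R_pid PP)[u [s /transfer_factorization]].
move: (f u) (map phi s) => v t [vv tQ ->].
rewrite mulf_neq0//; first by apply: contraTneq vv => ->; rewrite unitr0.
rewrite prodf_seq_neq0; apply/allP => q qt /=.
by have [] := Qprime q (tQ q qt).
Qed.

Lemma transferK x : x != 0 -> T' (T x) = x.
Proof.
have [_ _ fK _] := ff'; have [_ _ phiK _] := phiphi'.
move=> /(factorization_exists R_pid PP)[u [s xus]].
have := transfer_factorization xus => /(transferE f' phi' S_pid QQ) => TE.
rewrite /T' TE; case: xus => uu sP ->; rewrite fK// big_map; congr (_ * _).
by apply: eq_big_seq => p ps; rewrite phiK//; exact: sP.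
Qed.

(** Both sides are membership in the list of a factorization, and [phi] is injective on [P]. *)
Lemma divides_transfer x p : x != 0 -> P p ->
  divides (phi p) (T x) <-> divides p x.
Proof.
have [phiQ _ phiK _] := phiphi'.
move=> /(factorization_exists R_pid PP)[u [s xus]] Pp.
have sP : forall q, q \in s -> P q by case: xus.
rewrite (prime_divides_factorization PP xus)//.
rewrite (prime_divides_factorization QQ (transfer_factorization xus));
  last exact: phiQ.
split; last exact: map_f.
by move=> /mapP[q qs pq]; rewrite -(phiK p)// pq phiK//; exact: sP.
Qed.

End TransferBijection.

Section CoprimeTransfer.
Context {R S : idomainType} (R_pid : is_pid R) (S_pid : is_pid S).
Context {P : set R} {Q : set S} (PP : prime_system P) (QQ : prime_system Q).
Context {f phi : R -> S} {f' phi' : S -> R}.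
Hypotheses (ff' : inverse_on (units R) (units S) f f')
           (phiphi' : inverse_on P Q phi phi').

(** Both sides say that no chosen prime [p] divides [x] while [phi p] divides [k]. This adjunction
    makes the preimage of a basic open set basic. *)
Lemma coprime_transfer (x : R) (k : S) : x != 0 -> k != 0 ->
  coprime_elts (transfer P f phi x) k <->
  coprime_elts x (transfer Q f' phi' k).
Proof.
move=> x0 k0; have f'f := inverse_on_sym ff'.
have phi'phi := inverse_on_sym phiphi'.
have [phiQ phiP phiK phi'K] := phiphi'.
have Tx0 := transfer_neq0 R_pid PP QQ ff' phiphi' x0.
rewrite (coprime_eltsP R_pid PP _ x0) (coprime_eltsP S_pid QQ _ Tx0).
split=> h.
- move=> p Pp px; have Qp := phiQ p Pp.
  rewrite -(phiK p Pp) (divides_transfer S_pid QQ PP f'f phi'phi)//.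
  by apply: h => //; apply/(divides_transfer R_pid PP QQ ff' phiphi').
- move=> q Qq; have Pq := phiP q Qq; rewrite -(phi'K q Qq).
  rewrite (divides_transfer R_pid PP QQ ff' phiphi')// => /(h _ Pq).
  by rewrite phi'K// (divides_transfer S_pid QQ PP f'f phi'phi).
Qed.

End CoprimeTransfer.

(** * Open sets of the Macías space and the construction of a homeomorphism *)

Section MaciasSpace.
Context {R : idomainType}.
Implicit Types (x y k : macias R) (A : set (macias R)).

Lemma sigma0_coprime k x : sigma0 k x <-> coprime_elts (val k) (val x).
Proof. exact: sigma0P. Qed.

Lemma macias_openP A :
  open A <-> forall x, A x -> exists2 k, sigma0 k x & sigma0 k `<=` A.
Proof.
split=> [[D _ <-] x [k Dk kx]|h]; first by exists k => // y ky; exists k.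
(* The largest index set whose basic open sets stay inside [A]. *)
exists [set k | sigma0 k `<=` A] => //.
apply/seteqP; split=> [x [k /= kA kx]|x /h[k kx kA]]; first exact: kA.
by exists k.
Qed.

Lemma sigma0_open k : open (sigma0 k).
Proof. by apply/macias_openP => x kx; exists k. Qed.

End MaciasSpace.

Lemma macias_continuous (R S : idomainType) (h : macias R -> macias S)
    (g : macias S -> macias R) :
  (forall x k, sigma0 k (h x) <-> sigma0 (g k) x) -> continuous h.
Proof.
move=> hg; apply/continuousP => A /macias_openP Aop; apply/macias_openP => x.
move=> /Aop[k kx kA]; exists (g k); first exact/hg.
by move=> y /hg /kA.
Qed.

Lemma macias_homeomorphic (R S : idomainType) : is_pid R -> is_pid S ->
  units R #= units S -> prime_classes R #= prime_classes S ->
  homeomorphic (macias R) (macias S).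
Proof.
move=> R_pid S_pid /(inverse_of_card_eq (0 : R) (0 : S))[f [f' ff']] PS.
have [P PP Pcard] := prime_system_exists R.
have [Q QQ Qcard] := prime_system_exists S.
have : P #= Q.
  apply: card_eq_trans Pcard _; apply: card_eq_trans PS _.
  by rewrite card_eq_sym.
move=> /(inverse_of_card_eq (0 : R) (0 : S))[phi [phi' phiphi']].
have f'f := inverse_on_sym ff'; have phi'phi := inverse_on_sym phiphi'.
pose h (x : macias R) : macias S :=
  Sub (transfer P f phi (val x))
      (transfer_neq0 R_pid PP QQ ff' phiphi' (valP x)).
pose g (x : macias S) : macias R :=
  Sub (transfer Q f' phi' (val x))
      (transfer_neq0 S_pid QQ PP f'f phi'phi (valP x)).
have hg x k : sigma0 k (h x) <-> sigma0 (g k) x.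
  (* [sigma0] puts the index [k] first while [coprime_transfer] puts the point first, hence the
     symmetry on both sides. *)
  rewrite !sigma0_coprime !SubK; split=> /coprime_eltsC c; apply/coprime_eltsC.
    exact/(coprime_transfer R_pid S_pid PP QQ ff' phiphi' (valP x) (valP k)).
  exact/(coprime_transfer R_pid S_pid PP QQ ff' phiphi' (valP x) (valP k)).
have gh x k : sigma0 k (g x) <-> sigma0 (h k) x.
  rewrite !sigma0_coprime !SubK; split=> /coprime_eltsC c; apply/coprime_eltsC.
    exact/(coprime_transfer S_pid R_pid QQ PP f'f phi'phi (valP x) (valP k)).
  exact/(coprime_transfer S_pid R_pid QQ PP f'f phi'phi (valP x) (valP k)).
exists h, g; split.
- exact: macias_continuous hg.
- exact: macias_continuous gh.
- move=> x; apply: val_inj; rewrite !SubK.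
  exact (transferK R_pid S_pid PP QQ ff' phiphi' (valP x)).
- move=> x; apply: val_inj; rewrite !SubK.
  exact (transferK S_pid R_pid QQ PP f'f phi'phi (valP x)).
Qed.

(** * The specialization preorder and its meaning in the Macías space *)

Definition specializes {X : topologicalType} (x y : X) : Prop :=
  forall A : set X, open A -> A y -> A x.

Section Specialization.
Context {X : topologicalType}.
Implicit Types x y z : X.

Lemma specializes_trans y x z :
  specializes x y -> specializes y z -> specializes x z.
Proof. by move=> xy yz A Aop /yz-/(_ Aop)/xy; exact. Qed.

(** Equality in the Kolmogorov quotient. A homeomorphism may send a prime to a proper power of a
    prime, so primes can only be tracked up to this relation. *)
Definition indistinguishable x y := specializes x y /\ specializes y x.

Lemma indistinguishable_sym x y :
  indistinguishable x y -> indistinguishable y x.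
Proof. by case. Qed.

Lemma indistinguishable_trans y x z :
  indistinguishable x y -> indistinguishable y z -> indistinguishable x z.
Proof.
by move=> [xy yx] [yz zy]; split; [exact: specializes_trans xy yz|
  exact: specializes_trans zy yx].
Qed.

End Specialization.

Lemma continuous_specializes {X Y : topologicalType} (h : X -> Y) x y :
  continuous h -> specializes x y -> specializes (h x) (h y).
Proof.
by move=> /continuousP hc xy A Aop; apply: (xy (h @^-1` A)); exact: hc.
Qed.

Lemma continuous_indistinguishable {X Y : topologicalType} (h : X -> Y) x y :
  continuous h -> indistinguishable x y -> indistinguishable (h x) (h y).
Proof. by move=> hc [xy yx]; split; exact: continuous_specializes. Qed.

Section MaciasSpecialization.
Context {R : idomainType}.
Implicit Types x y k : macias R.

(** It is enough to test basic open sets. In a PID the condition says that every prime divisor of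
    [x] divides [y], so smaller elements have fewer prime divisors. *)
Lemma macias_specializesP x y : specializes x y <->
  forall k, coprime_elts (val k) (val y) -> coprime_elts (val k) (val x).
Proof.
split=> [xy k /sigma0_coprime ky|xy A /macias_openP Aop /Aop[k ky]].
  by apply/sigma0_coprime; apply: xy ky; exact: sigma0_open.
by apply; apply/sigma0_coprime/xy/sigma0_coprime.
Qed.

Lemma unit_specializesP x :
  val x \is a GRing.unit <-> forall y, specializes x y.
Proof.
split=> [xu y|/(_ (macias1 R))/macias_specializesP/(_ x) xx].
  apply/macias_specializesP => k _; exists 0, (val x)^-1.
  by rewrite mulr0 add0r divrr.
by apply: coprime_elts_self; apply: xx; exists 0, 1; rewrite mulr0 add0r mulr1.
Qed.

Lemma divides_specializes x y : divides (val x) (val y) -> specializes x y.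
Proof. by move=> xy; apply/macias_specializesP => k; exact: coprime_elts_dvd. Qed.

Context (R_pid : is_pid R).

Lemma prime_specializes x y : is_prime (val x) -> specializes x y ->
  divides (val x) (val y).
Proof.
move=> xp /macias_specializesP xy; have [_ /negP xu _] := xp.
apply: contrapT => /(prime_coprime R_pid xp)/xy.
by move=> /coprime_elts_self.
Qed.

Lemma prime_atom x y : is_prime (val x) -> specializes y x ->
  val y \isn't a GRing.unit -> specializes x y.
Proof.
move=> xp /macias_specializesP yx yu; apply: divides_specializes.
apply: contrapT => /(prime_coprime R_pid xp)/coprime_eltsC/yx.
by move=> /coprime_elts_self; apply/negP.
Qed.

Lemma prime_indistinguishableP x y : is_prime (val x) -> is_prime (val y) ->
  indistinguishable x y <-> associates (val x) (val y).
Proof.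
move=> xp yp; split=> [[/(prime_specializes xp) xy _]|xy].
  exact/associates_sym/prime_divides_associates.
by split; apply: divides_specializes; apply: associates_dvd => //;
  exact: associates_sym.
Qed.

End MaciasSpecialization.

Section HomeomorphismInvariants.
Context {R S : idomainType} (R_pid : is_pid R) (S_pid : is_pid S).
Context {h : macias R -> macias S} {g : macias S -> macias R}.
Hypotheses (hc : continuous h) (gc : continuous g).
Hypotheses (hK : cancel h g) (gK : cancel g h).

Lemma homeomorphism_unit x :
  val x \is a GRing.unit -> val (h x) \is a GRing.unit.
Proof.
move=> /unit_specializesP xu; apply/unit_specializesP => y; rewrite -(gK y).
exact: continuous_specializes.
Qed.

Lemma homeomorphism_prime x : is_prime (val x) ->
  exists2 q : macias S, is_prime (val q) & indistinguishable (h x) q.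
Proof.
move=> xp; have [x0 xu _] := xp.
have hxu : val (h x) \isn't a GRing.unit.
  apply: contra xu => /unit_specializesP hxu; apply/unit_specializesP => y.
  by rewrite -(hK x) -(hK y); exact: continuous_specializes.
have [Q QQ _] := prime_system_exists S.
have [q qp qhx] := prime_divisor S_pid QQ (valP (h x)) hxu.
have [q0 qu _] := qp.
pose q' : macias S := Sub q q0; exists q'; first by rewrite SubK.
have q'hx : specializes q' (h x) by apply: divides_specializes; rewrite SubK.
split=> //; rewrite -(gK q'); apply: continuous_specializes => //.
apply: prime_atom => //; first by rewrite -(hK x); exact: continuous_specializes.
apply: contra qu => /unit_specializesP gqu.
suff : val q' \is a GRing.unit by rewrite SubK.
apply/unit_specializesP => y; rewrite -(gK y) -(gK q').
exact: continuous_specializes.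
Qed.

Definition class_image (C : set R) : set S :=
  [set val q | q in [set q : macias S | is_prime (val q) /\
     exists2 p : macias R, C (val p) & indistinguishable (h p) q]].

Lemma class_imageE (p : macias R) (q : macias S) :
  is_prime (val p) -> is_prime (val q) -> indistinguishable (h p) q ->
  class_image [set r | associates r (val p)] = [set r | associates r (val q)].
Proof.
move=> pp qp hpq; apply/seteqP; split=> [_ [r [rp [p' /= p'p hp'r]] <-]|r rq] /=.
  apply/(prime_indistinguishableP S_pid) => //.
  apply: indistinguishable_trans hpq.
  apply: indistinguishable_trans (indistinguishable_sym hp'r) _.
  apply: continuous_indistinguishable => //.
  by apply/(prime_indistinguishableP R_pid) => //; exact: prime_associates p'p.
have rp := prime_associates qp rq; have [r0 _ _] := rp.
exists (Sub r r0); last by rewrite SubK.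
split; first by rewrite SubK.
exists p; first by exists 1; rewrite ?unitr1 ?mul1r.
apply: indistinguishable_trans hpq _; apply: indistinguishable_sym.
by apply/(prime_indistinguishableP S_pid); rewrite ?SubK.
Qed.

Lemma class_imageP C : prime_classes R C ->
  exists p q, [/\ is_prime (val p) /\ is_prime (val q),
    C = [set r | associates r (val p)],
    indistinguishable (h p) q &
    class_image C = [set r | associates r (val q)]].
Proof.
move=> [p0 pp <-]; have [p0_neq0 _ _] := pp.
have [p pE] : exists p : macias R, val p = p0 by exists (Sub p0 p0_neq0); rewrite SubK.
rewrite -pE in pp *.
have [q qp hpq] := homeomorphism_prime pp.
by exists p, q; split=> //; exact: class_imageE.
Qed.

End HomeomorphismInvariants.

Lemma homeomorphic_units (R S : idomainType) :
  homeomorphic (macias R) (macias S) -> units R #= units S.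
Proof.
move=> [h [g [hc gc hK gK]]].
pose F u := val (h (insubd (macias1 R) u)).
pose G u := val (g (insubd (macias1 S) u)).
have unit_neq0 (A : idomainType) (u : A) : units A u -> u != 0.
  by move=> uu; apply: contraTneq uu => ->; rewrite unitr0.
apply: (@card_eq_inverse _ _ _ _ F G); split=> u uu.
- apply: homeomorphism_unit gK _ _ => //.
  by rewrite insubdK//; exact: unit_neq0.
- apply: homeomorphism_unit hK _ _ => //.
  by rewrite insubdK//; exact: unit_neq0.
- by rewrite /G /F valKd hK insubdK//; exact: unit_neq0.
- by rewrite /G /F valKd gK insubdK//; exact: unit_neq0.
Qed.

Lemma homeomorphic_prime_classes (R S : idomainType) : is_pid R -> is_pid S ->
  homeomorphic (macias R) (macias S) -> prime_classes R #= prime_classes S.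
Proof.
move=> R_pid S_pid [h [g [hc gc hK gK]]].
apply: (@card_eq_inverse _ _ _ _ (class_image (h := h)) (class_image (h := g))).
split=> C.
- move=> /(class_imageP R_pid S_pid hc gc hK gK)[p [q [[pp qp] _ _ ->]]].
  by exists (val q).
- move=> /(class_imageP S_pid R_pid gc hc gK hK)[p [q [[pp qp] _ _ ->]]].
  by exists (val q).
- move=> /(class_imageP R_pid S_pid hc gc hK gK)[p [q [[pp qp] -> hpq ->]]].
  apply: class_imageE => //; rewrite -(hK p).
  by apply: continuous_indistinguishable => //; exact: indistinguishable_sym.
- move=> /(class_imageP S_pid R_pid gc hc gK hK)[p [q [[pp qp] -> hpq ->]]].
  apply: class_imageE => //; rewrite -(gK p).
  by apply: continuous_indistinguishable => //; exact: indistinguishable_sym.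
Qed.

Unset Implicit Arguments.

Theorem theorem4p1 (R S : idomainType)
    (R_infinite : infinite_set [set: R]) (S_infinite : infinite_set [set: S])
    (R_pid : is_pid R) (S_pid : is_pid S)
    (R_not_field : ~ GRing.field_axiom R)
    (S_not_field : ~ GRing.field_axiom S) :
  homeomorphic (macias R) (macias S) <->
    units R #= units S /\ prime_classes R #= prime_classes S.
Proof.
split=> [RS|[US PS]]; last exact: macias_homeomorphic.
by split; [exact: homeomorphic_units|exact: homeomorphic_prime_classes].
Qed.
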